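(* Let $G=\langle g_1,\ldots,g_n\rangle$ be an $n$-generated group acting by isometries on an $\mathbb{R}$-tree $X$. Then either $G$ is a free group of rank $n$ with free basis $g_1,\ldots,g_n$ which acts freely on $X$ with the orbit map being a quasi-isometric embedding, or for any $\epsilon>0$ there is a tuple $(h_1,\ldots,h_n)\in G^n$ Nielsen-equivalent to $(g_1,\ldots,g_n)$ such that $\|h_1\|\le\epsilon$.
   Context: For $g\in G$, $\|g\|:=\inf\{d(x,gx)\mid x\in X\}$ is the translation length of $g$. The orbit map is the map $G\to X$, $h\mapsto hx$ for a point $x\in X$, where $G$ carries the word metric with respect to the free basis $g_1,\ldots,g_n$. $\mathbb{R}$-trees are precisely the $0$-hyperbolic geodesic metric spaces (every side of a geodesic triangle is contained in the union of the other two sides). Nielsen equivalence: for an $n$-tuple $(g_1,\ldots,g_n)\in G^n$ the elementary Nielsen moves are: (N1) for some $i$ replace $g_i$ by $g_i^{-1}$; (N2) for some $i\neq j$ replace $g_i$ by $g_ig_j$; (N3) for some $i\neq j$ interchange $g_i$ and $g_j$. Two $n$-tuples are Nielsen-equivalent if one can be transformed into the other by a finite chain of elementary Nielsen moves. *)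

(* Defs.v *)
From HB Require Import structures.
From mathcomp Require Import all_boot all_order all_algebra perm monoid.
From mathcomp Require Import all_classical all_reals all_analysis.
From Stdlib Require Export Relation_Operators.

Set Implicit Arguments.
Unset Strict Implicit.
Unset Printing Implicit Defensive.

Import Order.TTheory GRing.Theory Num.Theory.

Local Open Scope classical_set_scope.
Local Open Scope ring_scope.

Section Words.
Context (G : groupType) (n : nat).
Implicit Types (g : {ffun 'I_n -> G}) (x : G).

(* The letter (i, false) stands for g_i and (i, true) for g_i^-1. *)
Definition letter : Type := ('I_n * bool)%type.

Definition eval_letter g (a : letter) : G :=
  (if a.2 then (g a.1)^-1 else g a.1)%g.

Definition eval_word g (w : seq letter) : G :=
  (\prod_(a <- w) eval_letter g a)%g.

Definition reduced (w : seq letter) : bool :=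
  sorted (fun a b : letter => b != (a.1, ~~ a.2)) w.

Definition generates g : Prop := forall x, exists w, eval_word g w = x.

Definition free_basis g : Prop :=
  forall x, exists! w, reduced w /\ eval_word g w = x.

End Words.

Section WordMetric.
Context (R : realType) (G : groupType) (n : nat).

(* When g generates G this infimum of natural numbers is a minimum. *)
Definition word_length (g : {ffun 'I_n -> G}) (x : G) : R :=
  inf [set (size w)%:R | w in [set w | eval_word g w = x]].

(* Left-invariant, to match orbit maps h |-> h x of left actions. *)
Definition word_dist (g : {ffun 'I_n -> G}) (x y : G) : R :=
  word_length g (x^-1 * y)%g.

End WordMetric.

Section Nielsen.
Context (G : groupType) (n : nat).

Inductive nielsen_move (g : {ffun 'I_n -> G}) : {ffun 'I_n -> G} -> Prop :=
| NielsenInv (i : 'I_n) :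
    nielsen_move g [ffun k => if k == i then (g i)^-1 else g k]%g
| NielsenMul (i j : 'I_n) : i != j ->
    nielsen_move g [ffun k => if k == i then g i * g j else g k]%g
| NielsenSwap (i j : 'I_n) : i != j ->
    nielsen_move g [ffun k => g (tperm i j k)].

Definition nielsen_equivalent : {ffun 'I_n -> G} -> {ffun 'I_n -> G} -> Prop :=
  clos_refl_trans _ nielsen_move.

End Nielsen.

Section Trees.
Context (R : realType) (X : metricType R).

(* Only the restriction of c to [0, d(x, y)] matters. *)
Definition geodesic (c : R -> X) (x y : X) : Prop :=
  [/\ c 0 = x, c (mdist x y) = y &
      {in `[0, mdist x y] &, forall s t, mdist (c s) (c t) = `|s - t|}].

Definition geodesic_segment (x y : X) (S : set X) : Prop :=
  exists2 c, geodesic c x y & S = c @` `[0, mdist x y].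

Definition geodesic_space : Prop :=
  forall x y : X, exists S, geodesic_segment x y S.

(* One side suffices: the vertices can be permuted cyclically. *)
Definition zero_hyperbolic : Prop :=
  forall (x y z : X) (A B C : set X),
    geodesic_segment x y A -> geodesic_segment y z B ->
    geodesic_segment z x C -> A `<=` B `|` C.

Definition R_tree : Prop :=
  [/\ [set: X] !=set0, geodesic_space & zero_hyperbolic].

End Trees.

Section Actions.
Context (R : realType) (G : groupType) (X : metricType R).

Definition isometric_action (act : G -> X -> X) : Prop :=
  [/\ forall x, act 1%g x = x,
      forall a b x, act (a * b)%g x = act a (act b x) &
      forall a x y, mdist (act a x) (act a y) = mdist x y].

Definition acts_freely (act : G -> X -> X) : Prop :=
  forall a x, act a x = x -> a = 1%g.

Definition translation_length (act : G -> X -> X) (a : G) : R :=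
  inf [set mdist x (act a x) | x in [set: X]].

End Actions.

Definition quasi_isometric_embedding (R : realType) (A B : Type)
    (dA : A -> A -> R) (dB : B -> B -> R) (f : A -> B) : Prop :=
  exists k c : R, [/\ 1 <= k, 0 <= c & forall a b,
    k^-1 * dA a b - c <= dB (f a) (f b) <= k * dA a b + c].

(* Main.v *)
(* Idea. For a tuple h Nielsen-equivalent to g and points p_i of X, let K be the
   convex hull of the 2n points p_i, h_i p_i. It is a fundamental domain, cut open
   at the p_i, for a marked graph with an equivariant map from its universal cover
   to X. Choose (h, p) such that the total length of K is within e of its infimum.

   If all translation lengths of Nielsen-equivalent tuples exceed eps, the segment
   from p_i to h_i p_i contains a point c far from the branch points of K. Cutting
   K at c instead of p_i and regluing at p_i changes h by a Whitehead automorphism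
   and does not lengthen the hull; by near minimality the two pieces overlap by at
   most e. After n such exchanges every point p_i, h_i p_i is the end of a long leg
   of K. By near minimality again, K and its neighbours h_i K, h_i^-1 K can then
   overlap near the end of a leg by at most e, since a longer overlap could be
   folded. So paths crossing the translates of K along a reduced word are local
   quasi-geodesics with small Gromov products at long steps, and in a tree the
   displacement is bounded below by a multiple of the length of the word. *)

Require Import Defs.
From mathcomp Require Import all_boot all_order all_algebra monoid perm.
From mathcomp Require Import all_classical all_reals all_analysis.
From mathcomp Require Import lra.

Set Implicit Arguments.
Unset Strict Implicit.
Unset Printing Implicit Defensive.

Import Order.TTheory GRing.Theory Num.Theory.

Local Open Scope classical_set_scope.
Local Open Scope ring_scope.

(** * Gromov products in R-trees *)

Section GromovProduct.
Context (R : realType) (X : metricType R).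
Implicit Types (w x y z : X).
Local Notation d := (@mdist R X).

Definition gromov w x y : R := (d w x + d w y - d x y) / 2.

Lemma gromovC w x y : gromov w x y = gromov w y x.
Proof. by rewrite /gromov (metric_sym x y); lra. Qed.

Lemma gromov_ge0 w x y : 0 <= gromov w x y.
Proof.
by have := metric_triangle x w y; rewrite /gromov (metric_sym x w); lra.
Qed.

Lemma gromov_le w x y : gromov w x y <= d w x.
Proof.
by have := metric_triangle w x y; rewrite /gromov; lra.
Qed.

Lemma gromovxx w x : gromov w x x = d w x.
Proof. by rewrite /gromov mdistxx; lra. Qed.

(** In a tree the two products are the distances from [w] and from [x] to the projection of [y] on
    the segment between them. *)
Lemma gromov_swap w x y : gromov w x y = d w x - gromov x w y.
Proof. by rewrite /gromov (metric_sym x w); lra. Qed.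

Lemma geodesic_rev (c : R -> X) x y :
  geodesic c x y -> geodesic (fun t => c (d x y - t)) y x.
Proof.
case=> c0 cD ci; split.
- by rewrite subr0.
- by rewrite (metric_sym y x) subrr.
- rewrite (metric_sym y x) => s t; rewrite !in_itv/= => sD tD.
  rewrite ci ?in_itv/=; [|lra|lra].
  by rewrite opprB addrC addrA subrK distrC.
Qed.

Lemma geodesic_segment_rev x y (S : set X) :
  geodesic_segment x y S -> geodesic_segment y x S.
Proof.
case=> c geo ->; exists (fun t => c (d x y - t)); first exact: geodesic_rev.
rewrite (metric_sym y x); apply/seteqP; split=> [_ [t /= tD <-]|_ [t /= tD <-]].
  exists (d x y - t); last by rewrite opprB addrC subrK.
  by move: tD; rewrite /= !in_itv/=; lra.
by exists (d x y - t) => //; move: tD; rewrite /= !in_itv/=; lra.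
Qed.

Lemma geodesic_dist (c : R -> X) x y (t : R) : geodesic c x y -> 0 <= t <= d x y ->
  d x (c t) = t /\ d (c t) y = d x y - t.
Proof.
case=> c0 cD ci tD; split.
  rewrite -[in LHS]c0 ci ?in_itv/=; [|lra|lra].
  by rewrite sub0r normrN ger0_norm//; lra.
rewrite -[in LHS]cD ci ?in_itv/=; [|lra|lra].
by rewrite distrC ger0_norm//; lra.
Qed.

Lemma interpolate x y (t : R) : geodesic_space X -> 0 <= t <= d x y ->
  exists2 c, d x c = t & d c y = d x y - t.
Proof.
move=> geo tD; have [_ [c gc _]] := geo x y.
by have [? ?] := geodesic_dist gc tD; exists (c t).
Qed.

(* A point of [w, x] closer to [w] than the Gromov product is not on [x, y]. *)
Lemma geodesic_prefix (cx cy : R -> X) w x y (s : R) :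
  geodesic_space X -> zero_hyperbolic X ->
  geodesic cx w x -> geodesic cy w y -> 0 <= s < gromov w x y -> cx s = cy s.
Proof.
move=> geo hyp gx gy /andP[s0 sxy].
have sx : 0 <= s <= d w x by have := gromov_le w x y; lra.
have [_ [c gc _]] := geo x y.
have Sx : geodesic_segment w x (cx @` `[0, d w x]) by exists cx.
have Sc : geodesic_segment x y (c @` `[0, d x y]) by exists c.
have Sy : geodesic_segment y w (cy @` `[0, d w y]).
  by apply: geodesic_segment_rev; exists cy.
have /(hyp _ _ _ _ _ _ Sx Sc Sy) : (cx @` `[0, d w x]) (cx s).
  by exists s => //=; rewrite in_itv.
have [dx dx'] := geodesic_dist gx sx.
case=> [[t /=]|[t /=]]; rewrite in_itv/= => tD et.
  have [ct ct'] := geodesic_dist gc tD.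
  have := metric_triangle w (cx s) y; rewrite dx -et ct'.
  have := dx'; rewrite -et (metric_sym (c t) x) ct.
  by move: sxy; rewrite /gromov => *; exfalso; lra.
have [ct _] := geodesic_dist gy tD.
by rewrite -[in RHS]dx -et ct.
Qed.

(** For [s] below both products the geodesics from [w] to [x], [y] and [z] agree at time [s], so [x]
    and [z] are joined through that point. The slack [e] provides the strict inequality that
    [geodesic_prefix] asks for. *)
Lemma four_point w x y z : R_tree X ->
  Order.min (gromov w x y) (gromov w y z) <= gromov w x z.
Proof.
case=> _ geo hyp; apply/ler_addgt0Pr => e e0; rewrite -lerBlDr.
set s := _ - e.
have [s0|s0] := ltP s 0; first exact: le_trans (ltW s0) (gromov_ge0 _ _ _).
have sxy : s < gromov w x y.
  by apply: (@lt_le_trans _ _ (Order.min (gromov w x y) (gromov w y z)));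
    rewrite ?ge_min ?lexx// /s; lra.
have syz : s < gromov w y z.
  by apply: (@lt_le_trans _ _ (Order.min (gromov w x y) (gromov w y z)));
    rewrite ?ge_min ?lexx ?orbT// /s; lra.
have [_ [cx gx _]] := geo w x; have [_ [cy gy _]] := geo w y.
have [_ [cz gz _]] := geo w z.
have exz : cx s = cz s.
  by rewrite (geodesic_prefix geo hyp gx gy) ?s0// (geodesic_prefix geo hyp gy gz) ?s0.
have sx : 0 <= s <= d w x by have := gromov_le w x y; lra.
have sz : 0 <= s <= d w z by have := gromov_le w z y; rewrite gromovC; lra.
have [dx dx'] := geodesic_dist gx sx; have [_ dz'] := geodesic_dist gz sz.
have := metric_triangle x (cx s) z.
by rewrite {2}exz dz' (metric_sym x (cx s)) dx' /gromov; lra.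
Qed.

Lemma four_point_le (v : R) w x y z : R_tree X ->
  v <= gromov w x y -> v <= gromov w y z -> v <= gromov w x z.
Proof.
move=> tree vx vz; apply: le_trans (four_point w x y z tree).
by rewrite le_min vx.
Qed.

Lemma four_point_le_or w x y z (v : R) : R_tree X ->
  gromov w x z <= v -> gromov w x y <= v \/ gromov w y z <= v.
Proof.
move=> tree h; apply/orP; rewrite -ge_min.
exact: le_trans (four_point w x y z tree) h.
Qed.

(* The candidates [(2k+1)r] on [x, y] are [2r] apart, so finitely many
   projections [P i] cannot come within [r] of all of them. *)
Lemma exists_clear_point (I : finType) (P : I -> X) x y (r : R) :
  geodesic_space X -> 0 < r -> 2 * #|I|.+1%:R * r <= d x y ->
  exists2 c, gromov c x y = 0 &
    forall i, r <= gromov c x (P i) \/ r <= gromov c y (P i).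
Proof.
move=> geo r0 Ir; pose t (k : nat) : R := (2 * k%:R + 1) * r.
have [k kP] : exists k : 'I_#|I|.+1, forall i, r <= `|t k - gromov x y (P i)|.
  apply: contrapT => /forallNP bad.
  have /choice[f fP] : forall k : 'I_#|I|.+1, exists i, `|t k - gromov x y (P i)| < r.
    by move=> k; apply: contrapT => /forallNP h; apply: (bad k) => i;
      rewrite leNgt; apply/negP/h.
  suff /leq_card : injective f by rewrite card_ord ltnn.
  have far (j k : nat) (u : R) : (j < k)%N -> `|t j - u| < r -> `|t k - u| < r -> False.
    rewrite -(ler_nat R) -natr1 => jk; rewrite !ltr_norml /t.
    have : 0 <= (k%:R - j%:R - 1) * r :> R by rewrite mulr_ge0 ?(ltW r0)//; lra.
    by rewrite !mulrDl !mulNr => *; lra.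
  move=> j k fjk; have hk := fP k; have := fP j; rewrite fjk => hj.
  apply/val_inj/eqP; rewrite eqn_leq.
  by apply/andP; split; rewrite leqNgt; apply/negP => jk;
    [exact: far jk hk hj|exact: far jk hj hk].
have tD : 0 <= t k <= d x y.
  have kI : (k.+1%:R : R) <= #|I|.+1%:R by rewrite ler_nat.
  rewrite -natr1 in kI; have k0 : 0 <= k%:R :> R by exact: ler0n.
  have : 0 <= (#|I|.+1%:R - k%:R - 1) * r by rewrite mulr_ge0 ?(ltW r0)//; lra.
  have : 0 <= k%:R * r by rewrite mulr_ge0 // ltW.
  by rewrite /t; move: Ir; rewrite !mulrDl !mulNr -!mulrA => *; lra.
have [c xc cy] := interpolate geo tD; exists c.
  by rewrite /gromov (metric_sym c x) xc cy; lra.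
move=> i; have := kP i; rewrite ler_normr.
(* The two products at [c] are nonnegative, so if their difference is at least [r] in absolute
   value, then so is one of them. *)
have -> : gromov x y (P i) = t k + gromov c y (P i) - gromov c x (P i).
  by rewrite /gromov (metric_sym c x) xc cy; lra.
have := gromov_ge0 c x (P i); have := gromov_ge0 c y (P i).
by move=> ? ? /orP[?|?]; [left|right]; lra.
Qed.

End GromovProduct.

(** * Length of convex hulls *)

Section HullLength.
Context (R : realType) (X : metricType R) (tree : R_tree X).
Implicit Types (x y s t : X) (S T : seq X).
Local Notation d := (@mdist R X).
Local Notation gp := (@gromov R X).

(* In a tree this is the distance from [s] to the convex hull of [x :: T]: the
   segments [x, t] cover the hull and lie at distance [gp s x t] from [s]. *)
Fixpoint hull_dist x T s : R :=
  if T is t :: T' then Order.min (gp s x t) (hull_dist x T' s) else d x s.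

(* Total length of the convex hull of [x :: S], added up point by point. *)
Fixpoint hull_length x S : R :=
  if S is s :: S' then hull_length x S' + hull_dist x S' s else 0.

Lemma le_hull_dist (v : R) x T s :
  v <= hull_dist x T s <-> v <= d x s /\ {in T, forall t, v <= gp s x t}.
Proof.
elim: T => [|t T IH] /=; first by split=> [|[]].
rewrite le_min; split=> [/andP[vt /IH[vx vT]]|[vx vT]].
  by split=> // u; rewrite inE => /predU1P[->|/vT].
rewrite vT ?mem_head//=; apply/IH; split=> // u uT.
by apply: vT; rewrite inE uT orbT.
Qed.

Lemma hull_dist_ge0 x T s : 0 <= hull_dist x T s.
Proof. by apply/le_hull_dist; split=> [|t _]; rewrite ?mdist_ge0 ?gromov_ge0. Qed.

Lemma hull_dist_le x T s : hull_dist x T s <= d x s.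
Proof. by have /le_hull_dist[] := lexx (hull_dist x T s). Qed.

Lemma hull_dist_le_gromov x T s t : t \in T -> hull_dist x T s <= gp s x t.
Proof. by move=> tT; have /le_hull_dist[_ ->] := lexx (hull_dist x T s). Qed.

Lemma hull_dist_sub x T T' s : {subset T <= T'} -> hull_dist x T' s <= hull_dist x T s.
Proof.
move=> TT'; apply/le_hull_dist; split=> [|t /TT']; first exact: hull_dist_le.
exact: hull_dist_le_gromov.
Qed.

Lemma hull_dist_eq x T T' s : T =i T' -> hull_dist x T s = hull_dist x T' s.
Proof. by move=> e; apply: le_anti; rewrite !hull_dist_sub// => t; rewrite e. Qed.

Lemma hull_dist_mem x T s : s \in T -> hull_dist x T s = 0.
Proof.
move=> sT; apply: le_anti; rewrite hull_dist_ge0 andbT.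
apply: le_trans (hull_dist_le_gromov x s sT) _.
by rewrite /gromov !mdistxx (metric_sym s x); lra.
Qed.

Lemma hull_dist_root x T : hull_dist x T x = 0.
Proof. by apply: le_anti; rewrite hull_dist_ge0 -[leRHS](mdistxx x) hull_dist_le. Qed.

(** The hypothesis says that [s] branches off the path to [t] outside the hull of [x :: T]. Hence
    the path to [s] leaves that hull at the same point, at distance [d x t - hull_dist x T t] from
    [x]. *)
Lemma hull_dist_swap_lt x T s t : gp t x s < hull_dist x T t ->
  hull_dist x T t + d x s - d x t <= hull_dist x T s.
Proof.
set H := hull_dist x T t => sH; apply/le_hull_dist; split.
  by have := hull_dist_le x T t; rewrite -/H; lra.
move=> u uT; have Hu : H <= gp t x u by apply: hull_dist_le_gromov.
rewrite (gromov_swap s) (metric_sym s x).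
have [] := @four_point_le_or _ _ x t s u (d x t - H) tree.
- by move: Hu; rewrite (gromov_swap t) (metric_sym t x); lra.
- by move: sH; rewrite (gromov_swap t) (metric_sym t x); lra.
by move=> ?; lra.
Qed.

(** If one point branches off the path to the other outside the hull of [x :: T], then both paths
    leave it at one point and the sums agree. Otherwise each point adds its own distance to that
    hull, in either order. *)
Lemma hull_length_swap x T s t :
  hull_length x [:: s, t & T] = hull_length x [:: t, s & T].
Proof.
rewrite /= -!addrA; congr +%R.
have ts : gp t x s = gp s x t + d x t - d x s.
  by rewrite /gromov (metric_sym t s) !(metric_sym _ x); lra.
case: (ltP (gp t x s) (hull_dist x T t)) => [/[dup] ? /hull_dist_swap_lt ?|?];
  case: (ltP (gp s x t) (hull_dist x T s)) => [/[dup] ? /hull_dist_swap_lt ?|?];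
  lra.
Qed.

Lemma hull_length_ge0 x S : 0 <= hull_length x S.
Proof. by elim: S => //= s S IH; rewrite addr_ge0// hull_dist_ge0. Qed.

Lemma hull_length_cons_le x s S : hull_length x S <= hull_length x (s :: S).
Proof. by rewrite /= lerDl hull_dist_ge0. Qed.

Lemma hull_length_cat_le x S T : hull_length x T <= hull_length x (S ++ T).
Proof.
by elim: S => //= s S IH; apply: le_trans IH (hull_length_cons_le _ _ _).
Qed.

Lemma hull_length_move x s S T :
  hull_length x (S ++ s :: T) = hull_length x (s :: S ++ T).
Proof.
elim: S => //= t S IH; have := hull_length_swap x (S ++ T) s t.
rewrite /= IH /= => ->; rewrite (_ : Order.min _ _ = hull_dist x (s :: S ++ T) t)//.
by congr (_ + _); apply: hull_dist_eq => u; rewrite mem_cat !inE mem_cat orbCA.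
Qed.

Lemma hull_length_catC x S T : hull_length x (S ++ T) = hull_length x (T ++ S).
Proof.
elim: S => [|s S IH]; first by rewrite cats0.
rewrite hull_length_move /= IH; congr +%R.
by apply: hull_dist_eq => u; rewrite !mem_cat orbC.
Qed.

Lemma hull_length_cat_sub x S T :
  {subset S <= T} -> hull_length x (S ++ T) = hull_length x T.
Proof.
elim: S => //= s S IH sST; rewrite IH => [|u uS]; last first.
  by apply: sST; rewrite inE uS orbT.
by rewrite hull_dist_mem ?addr0// mem_cat sST ?orbT// mem_head.
Qed.

Lemma hull_length_sub x S T :
  {subset S <= T} -> hull_length x S <= hull_length x T.
Proof.
move=> ST; rewrite -(hull_length_cat_sub x ST) hull_length_catC.
exact: hull_length_cat_le.
Qed.

Lemma hull_length_eq x S T : S =i T -> hull_length x S = hull_length x T.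
Proof. by move=> e; apply: le_anti; rewrite !hull_length_sub// => u; rewrite e. Qed.

Lemma hull_length_root_cons x S : hull_length x (x :: S) = hull_length x S.
Proof. by rewrite /= hull_dist_root addr0. Qed.

Lemma hull_dist_rcons x y S s :
  hull_dist x (rcons S y) s <= hull_dist y (rcons S x) s.
Proof.
apply/le_hull_dist; split=> [|t].
  apply: le_trans (@hull_dist_le_gromov x _ s y _) _.
    by rewrite mem_rcons mem_head.
  by rewrite gromovC (metric_sym y); apply: gromov_le.
rewrite mem_rcons inE => /predU1P[->|tS].
  rewrite gromovC; apply: hull_dist_le_gromov; first by rewrite mem_rcons mem_head.
apply: (four_point_le (y := x)) => //.
  by rewrite gromovC; apply: hull_dist_le_gromov; rewrite mem_rcons mem_head.
by apply: hull_dist_le_gromov; rewrite mem_rcons inE tS orbT.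
Qed.

Lemma hull_length_rerooted x y S :
  hull_length x (y :: S) = hull_length y (x :: S).
Proof.
(* With the exchanged root at the end of the list, the induction peels off the common points and
   stops at [d x y]. *)
have rc z T : rcons T z =i z :: T by move=> u; rewrite mem_rcons.
rewrite -(hull_length_eq _ (rc y S)) -(hull_length_eq _ (rc x S)).
elim: S => [|s S IH] /=; first by rewrite metric_sym.
by rewrite IH; congr +%R; apply: le_anti; rewrite !hull_dist_rcons.
Qed.

Lemma hull_length_root x y S :
  x \in S -> y \in S -> hull_length x S = hull_length y S.
Proof.
move=> xS yS; have e z : z \in S -> z :: S =i S.
  by move=> zS u; rewrite inE; case: eqP => [->|].
by rewrite -(hull_length_eq x (e y yS)) hull_length_rerooted (hull_length_eq y (e x xS)).
Qed.

Lemma hull_length_root_le x y S :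
  y \in S -> hull_length y S <= hull_length x S.
Proof.
move=> yS; rewrite -(hull_length_eq x (_ : y :: S =i S)); last first.
  by move=> u; rewrite inE; case: eqP => [->|].
by rewrite hull_length_rerooted hull_length_cons_le.
Qed.

Lemma hull_length_isom (f : X -> X) x S : (forall u v, d (f u) (f v) = d u v) ->
  hull_length (f x) (map f S) = hull_length x S.
Proof.
move=> fi; elim: S => //= s S ->; congr +%R.
by elim: S => //= t S ->; rewrite /gromov !fi.
Qed.

(** The segments from [p] to [x] and to [y] share an initial part of length [gp p x y], which the
    sum of the two lengths counts twice. *)
Lemma hull_length_merge p S T x y : x \in S -> y \in T ->
  hull_length p (S ++ T) <= hull_length p S + hull_length p T - gp p x y.
Proof.
(* The last entry is the first to be added to [S]: there [y] contributes at most [gp y p x] instead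
   of [d p y], and later points contribute no more than before. *)
move=> xS yT; have -> : hull_length p T = hull_length p (rcons T y).
  by apply: hull_length_eq => u; rewrite mem_rcons inE; case: eqP => [->|].
apply: (@le_trans _ _ (hull_length p (rcons T y ++ S))).
  apply: hull_length_sub => u; rewrite !mem_cat mem_rcons inE.
  by case/orP=> ->; rewrite ?orbT.
elim: (T) => [|t U IH] /=.
  have := hull_dist_le_gromov p y xS; rewrite (gromov_swap y) (metric_sym y p).
  by rewrite (gromovC p y); lra.
have := @hull_dist_sub p (rcons U y) (rcons U y ++ S) t.
move=> /(_ _)/wrap[u uU|]; first by rewrite mem_cat uU.
by move: IH; lra.
Qed.

(** Every path from [T] to [p] or to [S] passes through [c], so the two hulls meet only there. *)
Lemma hull_length_split p c S T : {in T, forall y, gp c p y = 0} ->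
  {in S & T, forall x y, gp c x y = 0} ->
  hull_length p (c :: S) + hull_length c T <= hull_length p (T ++ c :: S).
Proof.
move=> pT ST; elim: T => [|t T IH] in pT ST *; first by rewrite /= addr0.
have pt : gp c p t = 0 by rewrite pT ?mem_head.
have {}/IH IH : {in T, forall y, gp c p y = 0}.
  by move=> y yT; apply: pT; rewrite inE yT orbT.
have {}/IH IH : {in S & T, forall x y, gp c x y = 0}.
  by move=> x y xS yT; apply: ST; rewrite // inE yT orbT.
suff : hull_dist c T t <= hull_dist p (T ++ c :: S) t.
  by move: IH => /=; lra.
have ht : hull_dist c T t <= d c t by exact: hull_dist_le.
have ptE : d p t = d c p + d c t by move: pt; rewrite /gromov; lra.
apply/le_hull_dist; split; first by have := mdist_ge0 c p; lra.
move=> u; rewrite mem_cat inE => /or3P[uT|/eqP->|uS].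
- apply: le_trans (hull_dist_le_gromov c t uT) _.
  have pu : gp c p u = 0 by rewrite pT // inE uT orbT.
  move: pt pu; rewrite /gromov !(metric_sym t) ptE.
  by rewrite (metric_sym u t); lra.
- by rewrite /gromov !(metric_sym t) ptE (metric_sym p c); lra.
- have := ST u t uS (mem_head _ _); have := metric_triangle p c u.
  by rewrite /gromov !(metric_sym t) (metric_sym u t) ptE (metric_sym p c); lra.
Qed.

Lemma hull_length_between p c q S : q \in S -> gp c p q = 0 ->
  hull_length p (c :: S) = hull_length p S.
Proof.
move=> qS cpq; rewrite /=.
suff -> : hull_dist p S c = 0 by rewrite addr0.
by apply: le_anti; rewrite hull_dist_ge0 andbT -cpq hull_dist_le_gromov.
Qed.

(** Both distances from [z] in each product [gp z x t] drop by at least [s], hence so does the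
    product. *)
Lemma hull_length_slide x z z' S (s : R) : d x z' <= d x z - s ->
  {in S, forall t, d z' t <= d z t - s} ->
  hull_length x (z' :: S) + s <= hull_length x (z :: S).
Proof.
move=> xz Sz /=; suff : hull_dist x S z' + s <= hull_dist x S z by lra.
apply/le_hull_dist; split; first by have := hull_dist_le x S z'; lra.
move=> t tS; have := hull_dist_le_gromov x z' tS; have := Sz t tS.
by rewrite /gromov !(metric_sym _ x); lra.
Qed.

End HullLength.

(** * Words, free bases and Nielsen moves *)

Section WordTheory.
Context (G : groupType) (n : nat).
Implicit Types (g h u : {ffun 'I_n -> G}) (a b : letter n) (w v : seq (letter n)).

Definition inv_letter a : letter n := (a.1, ~~ a.2).

Definition inv_word w := rev (map inv_letter w).

Lemma inv_letterK : involutive inv_letter.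
Proof. by case=> i s; rewrite /inv_letter /= negbK. Qed.

Lemma inv_letter_neq a : inv_letter a != a.
Proof. by case: a => i []; rewrite xpair_eqE andbF. Qed.

Lemma eval_letter_inv g a : eval_letter g (inv_letter a) = ((eval_letter g a)^-1)%g.
Proof. by case: a => i [] /=; rewrite /eval_letter /= ?invgK. Qed.

Lemma eval_word_nil g : eval_word g [::] = 1%g.
Proof. by rewrite /eval_word big_nil. Qed.

Lemma eval_word_cons g a w : eval_word g (a :: w) = (eval_letter g a * eval_word g w)%g.
Proof. by rewrite /eval_word big_cons. Qed.

Lemma eval_word_cat g w v : eval_word g (w ++ v) = (eval_word g w * eval_word g v)%g.
Proof. by rewrite /eval_word big_cat. Qed.

Lemma eval_word_inv g w : eval_word g (inv_word w) = ((eval_word g w)^-1)%g.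
Proof.
rewrite /inv_word; elim: w => [|a w IH]; first by rewrite eval_word_nil invg1.
rewrite /= rev_cons -cats1 eval_word_cat IH !eval_word_cons eval_word_nil mulg1.
by rewrite eval_letter_inv invgM.
Qed.

Lemma reduced_cat w v a b : reduced (rcons w a ++ b :: v) =
  [&& reduced (rcons w a), b != inv_letter a & reduced (b :: v)].
Proof. by case: w => [|c w] //; rewrite /reduced /= cat_path last_rcons. Qed.

Lemma reduced_inv w : reduced w -> reduced (inv_word w).
Proof.
rewrite /reduced /inv_word rev_sorted sorted_map; apply: sub_sorted => a [j t].
by rewrite /= negbK eq_sym.
Qed.

(** The reduced word is the same for all [g], because [free_basis_extends] evaluates it at two
    tuples. *)
Lemma reduce_word w :
  exists2 w', reduced w' & forall g, eval_word g w' = eval_word g w.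
Proof.
elim: w => [|a w [w' rw' ew']]; first by exists [::].
case: w' rw' ew' => [|b w'] rw' ew'.
  by exists [:: a] => // g; rewrite !eval_word_cons ew'.
have [eb|nb] := eqVneq b (inv_letter a).
  exists w'; first exact: path_sorted rw'.
  by move=> g; rewrite eval_word_cons -ew' eval_word_cons eb eval_letter_inv mulVKg.
exists [:: a, b & w']; first by rewrite /reduced /= nb.
by move=> g; rewrite eval_word_cons ew' -eval_word_cons.
Qed.

(** After cancelling the common prefix of two reduced words with equal value, the inverse of one
    followed by the other is reduced and evaluates to 1. *)
Lemma free_basis_of_nontrivial h : generates h ->
  (forall w, reduced w -> w != [::] -> eval_word h w <> 1%g) -> free_basis h.
Proof.
move=> gen nt x; have [w0 <-] := gen x; have [w rw ew] := reduce_word w0.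
exists w; split=> // v [rv]; rewrite -ew {w0 ew} => evw.
elim: w v rw rv evw => [|a w IH] [|b v] //= rw rv.
- by rewrite eval_word_nil => /nt-/(_ rv isT).
- by rewrite eval_word_nil => /esym/nt-/(_ rw isT).
have [->|nab] := eqVneq a b.
  rewrite !eval_word_cons => /mulgI e; congr cons.
  by apply: IH => //; [exact: path_sorted rw|exact: path_sorted rv].
move=> e; case: (nt (inv_word (a :: w) ++ b :: v)).
- have := @reduced_inv (a :: w) rw; rewrite /inv_word /= rev_cons reduced_cat => ->.
  by rewrite inv_letterK eq_sym nab.
- by rewrite -size_eq0 size_cat addnS.
- by rewrite eval_word_cat eval_word_inv e mulVg.
Qed.

(** The universal property of a free basis, with target [G] only; unlike reducedness of words it is
    easily followed through a Nielsen move. *)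
Definition extends_to_hom g : Prop :=
  forall u, exists2 f : G -> G, {morph f : x y / (x * y)%g} & forall i, f (g i) = u i.

Lemma morph_group1 (f : G -> G) : {morph f : x y / (x * y)%g} -> f 1%g = 1%g.
Proof. by move=> fM; apply: (mulgI (f 1%g)); rewrite -fM !mulg1. Qed.

Lemma morph_groupV (f : G -> G) x : {morph f : x y / (x * y)%g} ->
  f (x^-1)%g = ((f x)^-1)%g.
Proof.
by move=> fM; apply: (mulgI (f x)); rewrite -fM !mulgV morph_group1.
Qed.

Lemma morph_eval_word (f : G -> G) g h w : {morph f : x y / (x * y)%g} ->
  (forall i, f (g i) = h i) -> f (eval_word g w) = eval_word h w.
Proof.
move=> fM fg; elim: w => [|a w IH]; first by rewrite !eval_word_nil morph_group1.
rewrite !eval_word_cons fM IH; congr (_ * _)%g.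
by case: a => i [] /=; rewrite /eval_letter /= ?morph_groupV// fg.
Qed.

Lemma free_basis_extends h : free_basis h -> extends_to_hom h.
Proof.
move=> free u; have /choice[W rW] : forall x, exists w, reduced w /\ eval_word h w = x.
  by move=> x; have [w []] := free x; exists w.
have ev w : eval_word u (W (eval_word h w)) = eval_word u w.
  have [w' rw' ew'] := reduce_word w; rewrite -(ew' u); congr eval_word.
  have [v [_ uv]] := free (eval_word h w).
  by rewrite -(uv _ (rW _)); apply: uv.
exists (fun x => eval_word u (W x)) => [x y|i] /=.
  have [_ {1}<-] := rW x; have [_ {1}<-] := rW y.
  by rewrite -eval_word_cat ev eval_word_cat.
have hi g : g i = eval_word g [:: (i, false)].
  by rewrite eval_word_cons eval_word_nil mulg1.
by rewrite (hi h) ev -hi.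
Qed.

Lemma extends_to_hom_move g h : nielsen_move g h -> extends_to_hom h -> extends_to_hom g.
Proof.
case=> [i|i j ij|i j ij] ext u.
- have [f fM fh] := ext [ffun k => if k == i then (u i)^-1 else u k]%g.
  exists f => // k; have := fh k; rewrite !ffunE; case: eqP => [->|] //.
  by rewrite morph_groupV// => /invg_inj.
- have [f fM fh] := ext [ffun k => if k == i then u i * u j else u k]%g.
  exists f => // k; have := fh k; rewrite !ffunE; case: eqP => [->|] //.
  have := fh j; rewrite !ffunE eq_sym (negbTE ij) fM => ->.
  exact: mulIg.
- have [f fM fh] := ext [ffun k => u (tperm i j k)].
  by exists f => // k; have := fh (tperm i j k); rewrite !ffunE tpermK.
Qed.

Lemma extends_to_hom_nielsen g h :
  nielsen_equivalent g h -> extends_to_hom h -> extends_to_hom g.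
Proof.
by elim=> [{}g {}h /extends_to_hom_move|//|k l m _ IH1 _ IH2 /IH2/IH1].
Qed.

Lemma eval_word_inj h w v : free_basis h -> reduced w -> reduced v ->
  eval_word h w = eval_word h v -> w = v.
Proof.
move=> free rw rv e; have [x [_ ux]] := free (eval_word h v).
by rewrite -(ux w)// -(ux v).
Qed.

(** A homomorphism sending [g] to [h] turns a relation between the [g i] into the same relation
    between the [h i]. *)
Lemma free_basis_nielsen g h :
  generates g -> nielsen_equivalent g h -> free_basis h -> free_basis g.
Proof.
move=> gen gh free; apply: free_basis_of_nontrivial => // w rw.
have [f fM fg] := extends_to_hom_nielsen gh (free_basis_extends free) h.
move=> wN0 e; move: wN0; rewrite (eval_word_inj free rw (v := [::]))//.
by rewrite -!(morph_eval_word _ fM fg) e eval_word_nil.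
Qed.

Definition spanned g x := exists w, eval_word g w = x.

Lemma spannedM g x y : spanned g x -> spanned g y -> spanned g (x * y)%g.
Proof. by move=> [w <-] [v <-]; exists (w ++ v); rewrite eval_word_cat. Qed.

Lemma spannedV g x : spanned g x -> spanned g (x^-1)%g.
Proof. by move=> [w <-]; exists (inv_word w); rewrite eval_word_inv. Qed.

Lemma spanned_gen g i : spanned g (g i).
Proof. by exists [:: (i, false)]; rewrite eval_word_cons eval_word_nil mulg1. Qed.

Lemma spanned_trans g h x :
  (forall i, spanned h (g i)) -> spanned g x -> spanned h x.
Proof.
move=> gh [w <-]; elim: w => [|[i s] w IH].
  by exists [::]; rewrite !eval_word_nil.
rewrite eval_word_cons; apply: spannedM => //.
by case: s; rewrite /eval_letter /=; [apply: spannedV|].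
Qed.

Lemma spanned_move g h i : nielsen_move g h -> spanned h (g i).
Proof.
case=> [j|j k jk|j k jk]; set h' := [ffun _ => _].
- have := spanned_gen h' i; rewrite ffunE; case: eqP => [->|//].
  by move=> /spannedV; rewrite invgK.
- have := spanned_gen h' i; rewrite ffunE; case: eqP => [->|//].
  have := spanned_gen h' k; rewrite ffunE eq_sym (negbTE jk) => /spannedV hk hj.
  by rewrite -(mulgK (g k) (g j)); apply: spannedM.
- by have := spanned_gen h' (tperm j k i); rewrite ffunE tpermK.
Qed.

Lemma spanned_nielsen g h x : nielsen_equivalent g h -> spanned g x -> spanned h x.
Proof.
elim=> [{}g {}h gh|//|k l m _ IH1 _ IH2 /IH1/IH2 //].
by apply: spanned_trans => i; apply: spanned_move.
Qed.

Lemma generates_nielsen g h : nielsen_equivalent g h -> generates g -> generates h.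
Proof. by move=> gh gen x; apply: spanned_nielsen gh (gen x). Qed.

Lemma word_translation g h : generates g ->
  exists C : nat, forall w,
    exists2 v, eval_word g v = eval_word h w & (size v <= C * size w)%N.
Proof.
move=> gen; have /choice[W hW] := fun i => gen (h i).
exists (\sum_i size (W i))%N => w; elim: w => [|[i s] w [v ev sv]].
  by exists [::]; rewrite ?eval_word_nil.
have sW : (size (W i) <= \sum_i size (W i))%N by rewrite (bigD1 i)//= leq_addr.
exists ((if s then inv_word (W i) else W i) ++ v).
  rewrite eval_word_cat eval_word_cons ev; congr (_ * _)%g.
  by case: s; rewrite /eval_letter ?eval_word_inv hW.
rewrite size_cat /= mulnS leq_add//.
by case: s => //; rewrite size_rev size_map.
Qed.

(** A Whitehead automorphism with multiplier [h i], carried out one entry at a time; the list in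
    [hs] holds the entries already treated. *)
Lemma nielsen_whitehead h i (l r : 'I_n -> bool) : nielsen_equivalent h
  [ffun j => if j == i then h i
             else (if l j then (h i)^-1 else 1) * h j * (if r j then h i else 1)]%g.
Proof.
pose t j := ((if l j then (h i)^-1 else 1) * h j * (if r j then h i else 1))%g.
pose hs (s : seq 'I_n) := [ffun j => if (j \in s) && (j != i) then t j else h j].
suff hhs s : uniq s -> nielsen_equivalent h (hs s).
  rewrite (_ : [ffun _ => _] = hs (enum 'I_n)); first exact/hhs/enum_uniq.
  by apply/ffunP => j; rewrite !ffunE mem_enum /=; case: eqP => [->|].
elim: s => [_|j s IH /= /andP[js us]].
  by rewrite (_ : hs [::] = h); [exact: rt_refl|apply/ffunP => j; rewrite ffunE].
apply: rt_trans (IH us) _.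
have [ji|ji] := eqVneq j i.
  rewrite (_ : hs (j :: s) = hs s); first exact: rt_refl.
  by apply/ffunP => k; rewrite !ffunE inE ji; case: (eqVneq k i); rewrite ?andbF.
pose upd (k : {ffun 'I_n -> G}) x := [ffun m => if m == j then x else k m].
have updu k x y : upd (upd k x) y = upd k y.
  by apply/ffunP => m; rewrite !ffunE; case: eqP.
have updi k x : upd k x i = k i by rewrite ffunE eq_sym (negbTE ji).
have updj k x : upd k x j = x by rewrite ffunE eqxx.
have inv k : nielsen_equivalent k (upd k (k j)^-1)%g by apply/rt_step/NielsenInv.
have mul k : nielsen_equivalent k (upd k (k j * k i))%g by apply/rt_step/NielsenMul.
have right k : nielsen_equivalent k (upd k (k j * (if r j then k i else 1)))%g.
  case: (r j); first exact: mul.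
  rewrite mulg1 (_ : upd _ _ = k); first exact: rt_refl.
  by apply/ffunP => m; rewrite ffunE; case: eqP => [->|].
have left k : nielsen_equivalent k (upd k ((if l j then (k i)^-1 else 1) * k j))%g.
  case: (l j); last first.
    rewrite mul1g (_ : upd _ _ = k); first exact: rt_refl.
    by apply/ffunP => m; rewrite ffunE; case: eqP => [->|].
  (* Left multiplication by the inverse is a right multiplication between two inversions. *)
  apply: rt_trans (inv k) _; apply: rt_trans (mul _) _.
  rewrite updu updi updj; have := inv (upd k ((k j)^-1 * k i))%g.
  by rewrite updu updj invgM invgK.
have hsi : hs s i = h i by rewrite ffunE eqxx andbF.
have hsj : hs s j = h j by rewrite ffunE (negbTE js).
apply: rt_trans (left _) _.
have := right (upd (hs s) ((if l j then (hs s i)^-1 else 1) * hs s j))%g.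
rewrite updu updi updj hsi hsj -/(t j) (_ : upd _ (t j) = hs (j :: s))//.
apply/ffunP => m; rewrite !ffunE inE; case: (eqVneq m j) => [->|//].
by rewrite ji.
Qed.

End WordTheory.

(** * Ping-pong *)

Section PingPong.
Context (R : realType) (G : groupType) (n : nat) (X : metricType R).
Context (act : G -> X -> X) (tree : R_tree X) (isom : isometric_action act).
Local Notation d := (@mdist R X).
Local Notation gp := (@gromov R X).

Lemma act1 x : act 1%g x = x. Proof. by case: isom. Qed.
Lemma actM a b x : act (a * b)%g x = act a (act b x). Proof. by case: isom. Qed.
Lemma act_dist a x y : d (act a x) (act a y) = d x y. Proof. by case: isom. Qed.
Lemma act_gromov a w x y : gp (act a w) (act a x) (act a y) = gp w x y.
Proof. by rewrite /gromov !act_dist. Qed.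
Lemma actK a x : act (a^-1)%g (act a x) = x.
Proof. by rewrite -actM mulVg act1. Qed.
Lemma actVK a x : act a (act (a^-1)%g x) = x.
Proof. by rewrite -actM mulgV act1. Qed.

(* [P a] is a point of both [K] and [a K], for [K] the hull of all the [P b]. *)
Definition paired (h : {ffun 'I_n -> G}) (P : letter n -> X) : Prop :=
  forall a, P a = act (eval_letter h a) (P (inv_letter a)).

Context (h : {ffun 'I_n -> G}) (P : letter n -> X) (e : R).
Hypotheses (e0 : 0 < e) (hP : paired h P).
(** [P a] is where the hull meets its translate along [a]; the product in [unfolded] measures their
    overlap from there. *)
Hypothesis sep : forall a b, a != b -> 4 * e <= d (P a) (P b).
Hypothesis unfolded : forall a b c, b != a -> c != inv_letter a ->
  gp (P a) (P b) (act (eval_letter h a) (P c)) <= e.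

(** By induction [P a] is the gate towards [y]: the other [P b] are farther by [2 * e], the gap
    [4 * e] less twice the overlap [e]. *)
Lemma displacement_letters w a
    (y := act (eval_word h (a :: w)) (P (inv_letter (last a w)))) :
  reduced (a :: w) ->
  2 * e * (size w)%:R <= d (P a) y /\ forall b, b != a -> d (P a) y + 2 * e <= d (P b) y.
Proof.
rewrite {}/y; elim: w a => [|c w IH] a rw.
  rewrite /= eval_word_cons eval_word_nil mulg1 -hP mdistxx mulr0; split=> // b ba.
  by have := sep ba; have := e0; lra.
have [ca rw'] : c != inv_letter a /\ reduced (c :: w) by move: rw => /andP.
have [IH1 IH2] := IH c rw'; rewrite eval_word_cons actM [last a _]/=.
set y := act _ (P (inv_letter (last c w))) in IH1 IH2 *.
have Pa : d (P a) (act (eval_letter h a) y) = d (P (inv_letter a)) y.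
  by rewrite {1}hP act_dist.
have IHa := IH2 (inv_letter a); rewrite eq_sym in IHa.
have {}IHa := IHa ca; split; first by rewrite Pa /= -natr1; lra.
(* The induction hypothesis and [sep] make the product of the tail with [P c] at least [3 * e], so
   the four-point alternative must bound the product of the tail with [P b]. *)
move=> b ba; have := unfolded ba ca.
move=> /(@four_point_le_or _ _ _ _ (act (eval_letter h a) y) _ _ tree).
have -> : gp (P a) (act (eval_letter h a) y) (act (eval_letter h a) (P c)) =
    gp (P (inv_letter a)) y (P c) by rewrite {1}hP act_gromov.
have := e0; have := sep ba; have := @sep (inv_letter a) c.
rewrite eq_sym => /(_ ca) s1 s2 e1.
rewrite /gromov Pa (metric_sym y) (metric_sym (P a) (P b)).
by case; lra.
Qed.

Lemma displacement_word x : exists2 M : R, 0 <= M & forall w, reduced w ->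
  2 * e * (size w)%:R - M <= d x (act (eval_word h w) x).
Proof.
pose M := \sum_a d x (P a).
have M0 : 0 <= M by apply: sumr_ge0 => a _; exact: mdist_ge0.
have xP a : d x (P a) <= M.
  by rewrite /M (bigD1 a)//= lerDl sumr_ge0// => b _; exact: mdist_ge0.
exists (2 * M) => [|w]; first by have := M0; lra.
case: w => [|a w] rw.
  by rewrite mulr0; have := mdist_ge0 x (act (eval_word h [::]) x); lra.
have [h1 h2] := displacement_letters rw.
(* Starting from [P (inv_letter a)] instead of [P a] gains the [2 * e] owed to the first letter. *)
have {}h2 := h2 _ (inv_letter_neq a).
set y := act _ _ in h1 h2; rewrite [size _]/= -natr1.
have := metric_triangle (P (inv_letter a)) x y.
have := metric_triangle x (act (eval_word h (a :: w)) x) y.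
rewrite /y act_dist -/y (metric_sym _ x).
have := xP (inv_letter a); have := xP (inv_letter (last a w)); lra.
Qed.

(** If the last letter is inverse to the first, conjugation gives a shorter nonempty reduced word
    with a fixed point. Otherwise all powers of [w] are reduced, and their displacement of [z] grows
    linearly. *)
Lemma word_no_fixpoint w z : reduced w -> w != [::] -> act (eval_word h w) z <> z.
Proof.
elim: {w}(size w) {-2}w (leqnn (size w)) z => [|k IH] [|a w] // sw z rw _ wz.
have [la|la] := eqVneq (last a w) (inv_letter a).
  move: rw sw wz; case/lastP: w la => [/esym/eqP|w l].
    by rewrite (negbTE (inv_letter_neq a)).
  rewrite last_rcons => -> rw; rewrite /= size_rcons ltnS => sw.
  rewrite eval_word_cons -cats1 eval_word_cat eval_word_cons eval_word_nil mulg1.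
  rewrite eval_letter_inv !actM => wz.
  apply: (IH w _ (act (eval_letter h a)^-1%g z)).
  - exact: ltnW.
  - by move: rw; rewrite /reduced /= rcons_path => /andP[/path_sorted].
  - by case: (w) rw => //; rewrite /reduced /= eqxx.
  - by rewrite -[LHS](actK (eval_letter h a)) wz.
have [M M0 hM] := displacement_word z.
pose pow N := flatten (nseq N (a :: w)).
have rpow N : reduced (pow N).
  elim: N => [//|[|N] IHN]; first by rewrite /pow /= cats0.
  rewrite /pow [flatten _]/= -[_ :: _ ++ _]/((a :: w) ++ (pow N.+1)) lastI.
  rewrite [pow _]/= reduced_cat -lastI rw IHN andbT /=.
  by apply: contraNneq la => e1; rewrite {2}e1 inv_letterK.
have spow N : size (pow N) = (N * (size w).+1)%N.
  by elim: N => //= N IHN; rewrite size_cat -/(pow N) IHN mulSn.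
have zpow N : act (eval_word h (pow N)) z = z.
  elim: N => [|N IHN]; first by rewrite eval_word_nil act1.
  by rewrite /pow /= -cat_cons eval_word_cat -/(pow N) actM IHN.
set N := Num.bound (M / (2 * e)).
have := hM _ (rpow N); rewrite zpow mdistxx spow subr_le0; apply/negP.
rewrite -ltNge; have e2 : 0 < 2 * e by rewrite mulr_gt0.
apply: (@lt_le_trans _ _ (2 * e * N%:R)); last first.
  by apply: ler_wpM2l; rewrite ?ler_nat ?leq_pmulr ?(ltW e2).
by rewrite mulrC -ltr_pdivrMr// archi_boundP// divr_ge0// ltW.
Qed.

Lemma ping_pong_free_basis : generates h -> free_basis h.
Proof.
move=> gen; apply: free_basis_of_nontrivial => // w rw wN0 ew.
have [[x _] _ _] := tree.
by apply: (@word_no_fixpoint w x); rewrite // ew act1.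
Qed.

Lemma ping_pong_acts_freely : generates h -> acts_freely act.
Proof.
move=> gen a x ax; have [w [[rw ew] _]] := ping_pong_free_basis gen a.
have [w0|wN0] := eqVneq w [::]; first by rewrite -ew w0 eval_word_nil.
by case: (@word_no_fixpoint w x rw wN0); rewrite ew.
Qed.

(** * Comparison with the word metric *)

Lemma word_length_le (g : {ffun 'I_n -> G}) w :
  word_length R g (eval_word g w) <= (size w)%:R.
Proof.
apply: ge_inf; last by exists w.
by exists 0 => _ [v _ <-]; exact: ler0n.
Qed.

Lemma dist_le_word_length (g : {ffun 'I_n -> G}) a x : generates g ->
  d x (act a x) <= (\sum_i d x (act (g i) x)) * word_length R g a.
Proof.
move=> gen; set C := \sum_i _.
have C0 : 0 <= C by apply: sumr_ge0 => i _; exact: mdist_ge0.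
have gC i : d x (act (g i) x) <= C.
  by rewrite /C (bigD1 i)//= lerDl sumr_ge0// => j _; exact: mdist_ge0.
have wC w : d x (act (eval_word g w) x) <= C * (size w)%:R.
  elim: w => [|[i s] w IH]; first by rewrite eval_word_nil act1 mdistxx mulr0.
  rewrite eval_word_cons actM [size _]/= -natr1 mulrDr mulr1.
  have l1 : d x (act (eval_letter g (i, s)) x) <= C.
    case: s; rewrite /eval_letter //=.
    by rewrite -[X in d X _](actK (g i)) act_dist metric_sym.
  have := metric_triangle x (act (eval_letter g (i, s)) x)
    (act (eval_letter g (i, s)) (act (eval_word g w) x)).
  by rewrite act_dist; move: l1 IH; lra.
have [w0 ew0] := gen a; have := wC w0; rewrite ew0.
(* The bound reaches the infimum by dividing by [C]. *)
have [->|CN0] := eqVneq C 0; first by rewrite !mul0r.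
move=> _; have Cgt0 : 0 < C by rewrite lt_neqAle eq_sym CN0.
rewrite -ler_pdivrMl//; apply: lb_le_inf; first by exists (size w0)%:R, w0.
by move=> _ [w /= <- <-]; rewrite ler_pdivrMl.
Qed.

Lemma ping_pong_quasi_isometric (g : {ffun 'I_n -> G}) x :
  generates g -> generates h ->
  quasi_isometric_embedding (word_dist R g) d (fun a => act a x).
Proof.
move=> gen genh; have [M M0 hM] := displacement_word x.
have [C hC] := word_translation h gen.
set K := \sum_i d x (act (g i) x).
have K0 : 0 <= K by apply: sumr_ge0 => i _; exact: mdist_ge0.
have e2 : 0 < 2 * e by have := e0; lra.
have C0 : 0 <= C%:R / (2 * e) by rewrite divr_ge0// ltW.
have k0 : 0 < 1 + K + C%:R / (2 * e) by lra.
(* [K] serves the upper bound. For the lower bound, [C] converts length in [h] to length in [g], and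
   each letter of [h] moves by [2 * e]. *)
exists (1 + K + C%:R / (2 * e)), M; split=> [||a b]; [lra|by []|].
have -> : d (act a x) (act b x) = d x (act (a^-1 * b)%g x).
  by rewrite actM -[in RHS](act_dist a) actVK.
rewrite /word_dist; set c := (a^-1 * b)%g.
have W0 : 0 <= word_length R g c.
  apply: lb_le_inf; first by have [w ew] := gen c; exists (size w)%:R, w.
  by move=> _ [w _ <-]; exact: ler0n.
apply/andP; split; last first.
  have := dist_le_word_length c x gen; rewrite -/K => /le_trans; apply.
  by rewrite -[leLHS]addr0 lerD// ler_wpM2r//; lra.
rewrite lerBlDr ler_pdivrMl//.
have [w [[rw ew] _]] := ping_pong_free_basis genh c.
have [v ev sv] := hC w.
have := word_length_le g v; rewrite ev ew => /le_trans; apply.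
apply: (@le_trans _ _ (C%:R * (size w)%:R)); first by rewrite -natrM ler_nat.
have wd : (size w)%:R <= (d x (act c x) + M) / (2 * e).
  by rewrite ler_pdivlMr//; have := hM w rw; rewrite ew; lra.
apply: (@le_trans _ _ (C%:R / (2 * e) * (d x (act c x) + M))).
  by rewrite [leRHS]mulrAC -mulrA; apply: ler_wpM2l; rewrite ?ler0n.
by rewrite ler_wpM2r ?addr_ge0 ?mdist_ge0//; lra.
Qed.

End PingPong.

(** * Shortening the hull *)

Section Exchange.
Context (R : realType) (G : groupType) (n : nat) (X : metricType R).
Context (act : G -> X -> X) (tree : R_tree X) (isom : isometric_action act).
Context (g : {ffun 'I_n -> G}).
Implicit Types (h : {ffun 'I_n -> G}) (P : letter n -> X) (a b : letter n).
Local Notation d := (@mdist R X).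
Local Notation gp := (@gromov R X).

(** The letter [b] only selects a root; by [volume_root] the value does not depend on it. *)
Definition volume b P : R := hull_length (P b) (codom P).

Definition near_minimal (e : R) P : Prop := forall h' P' b b',
  nielsen_equivalent g h' -> paired act h' P' -> volume b P <= volume b' P' + e.

(* The hull of all the [P b] ends at [P a] in a leg of length at least [r]. *)
Definition long (r : R) P a : Prop :=
  forall b c, b != a -> c != a -> r <= gp (P a) (P b) (P c).

Lemma volume_root P b b' : volume b P = volume b' P.
Proof. by apply: hull_length_root; rewrite // codom_f. Qed.

Lemma paired_half h P :
  (forall i, P (i, false) = act (h i) (P (i, true))) -> paired act h P.
Proof.
by move=> hP [i []]; rewrite /eval_letter /inv_letter /= hP// (actK isom).
Qed.

(** * One exchange of a cut point *)

Section Recut.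
Context (h : {ffun 'I_n -> G}) (P : letter n -> X) (i : 'I_n) (c : X) (r r0 e : R).
Context (s : seq 'I_n).
Hypotheses (gh : nielsen_equivalent g h) (hP : paired act h P).
Hypotheses (e0 : 0 <= e) (min : near_minimal e P).
(** [r0] is the clearance of [c], the same at every exchange; [r] is the leg length reached so far
    on [s], which shrinks. *)
Hypotheses (r00 : 0 < r0) (rr0 : r <= r0).
Hypothesis longs : forall j t, j \in s -> long r P (j, t).
Let z (t : bool) := P (i, t).
Hypothesis cz : gp c (z true) (z false) = 0.
Hypothesis clear : forall b, r0 <= gp c (z true) (P b) \/ r0 <= gp c (z false) (P b).

Let near b : bool := r0 <= gp c (z true) (P b).
(** The copy of [c] on the piece of [z true] is labelled [(i, false)] and the other [(i, true)], so
    that after the translation [h i] still carries the second to the first. *)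
Let side b : bool := if b.1 == i then ~~ b.2 else near b.
Let Q b : X := if b.1 == i then c else P b.
Let tau (t : bool) : G := (if t then 1 else (h i)^-1)%g.

(* [K] is cut at [c] instead of at [P i]; the piece on the side of [z false] is
   translated so that the two pieces are glued along the former cut point. *)
Definition recut b : X := act (tau (side b)) (Q b).

(** Both ends of the pair [j] are moved by their own [tau], so [h j] acquires one [tau] on the left
    and the inverse of the other on the right. *)
Definition recut_tuple : {ffun 'I_n -> G} :=
  [ffun j => if j == i then h i else
     (if ~~ near (j, false) then (h i)^-1 else 1) * h j *
     (if ~~ near (j, true) then h i else 1)]%g.

Lemma recut_nielsen : nielsen_equivalent g recut_tuple.
Proof. exact: rt_trans gh (nielsen_whitehead _ _ _ _). Qed.

Lemma recut_paired : paired act recut_tuple recut.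
Proof.
apply: paired_half => j; rewrite /recut /side /Q /= ffunE.
have [_|ji] := eqVneq j i; first by rewrite (act1 isom) (actVK isom).
have -> : P (j, false) = act (h j) (P (j, true)) by rewrite hP.
rewrite -!(actM isom); congr act; rewrite /tau.
by case: (near _); case: (near _); rewrite /= ?mulg1 ?mul1g ?mulgA ?mulgVK ?mulgK.
Qed.

Lemma tau_z t : act (tau t) (z t) = z true.
Proof.
by case: t; rewrite /tau /z ?(act1 isom)// hP /eval_letter (actK isom).
Qed.

Lemma cz_side t : gp c (z t) (z (~~ t)) = 0.
Proof. by case: t; rewrite // gromovC. Qed.

Lemma near_side b : r0 <= gp c (z (near b)) (P b).
Proof. by case nb : (near b) => //; case: (clear b) => //; rewrite -/(near b) nb. Qed.

Lemma far_side b : gp c (z (~~ near b)) (P b) = 0.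
Proof.
apply: le_anti; rewrite gromov_ge0 andbT.
(* Seen from [c], the two ends lie in different directions, and [P b] lies in that of
   [z (near b)]. *)
have zz : gp c (z (~~ near b)) (z (near b)) <= 0 by rewrite gromovC cz_side.
have [//|] := four_point_le_or (P b) tree zz.
by rewrite gromovC => bz; have := near_side b; have := r00; lra.
Qed.

Lemma near_z t : near (i, t) = t.
Proof.
apply/eqP; apply: contraT => nt.
have e1 : ~~ near (i, t) = t by case: t (near _) nt => [] [].
have := far_side (i, t); rewrite e1 gromovxx => ct.
have := near_side (i, t); have := gromov_le c (P (i, t)) (z (near (i, t))).
by rewrite gromovC ct; have := r00; lra.
Qed.

Let piece t := c :: [seq P b | b <- enum {: letter n} & near b == t].

Lemma piece_mem b : Q b \in piece (side b).
Proof.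
rewrite /Q /side; case: eqP => _; first exact: mem_head.
by rewrite inE (map_f P) ?orbT // mem_filter eqxx mem_enum.
Qed.

(** Cutting at [c] preserves the total length, and gluing at [z true] saves whatever the two pieces
    share there. *)
Lemma recut_volume x y b b' : x \in piece true -> y \in piece false ->
  volume b recut <= volume b' P - gp (z true) x (act (h i)^-1%g y).
Proof.
move=> xS yS; set p := z true; set q := z false.
pose S := [seq P b | b <- enum {: letter n} & near b == true].
pose T := [seq P b | b <- enum {: letter n} & near b == false].
have inP t b1 : near b1 = t -> P b1 \in [seq P b | b <- enum {: letter n} & near b == t].
  by move=> <-; apply: map_f; rewrite mem_filter eqxx mem_enum.
have pS : p \in S by apply: inP; rewrite near_z.
have qT : q \in T by apply: inP; rewrite near_z.
(* Adding [c] costs nothing, as it lies between [z true] and [z false]. *)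
have codomE : T ++ c :: S =i c :: codom P.
  move=> u; rewrite mem_cat !inE orbCA; congr orb.
  apply/orP/codomP => [[]/mapP[b1 _ ->]|[b1 ->]]; try by exists b1.
  by case e1 : (near b1); [right|left]; apply: inP.
have volP : volume b' P = hull_length p (T ++ c :: S).
  rewrite (volume_root P b' (i, true)) (hull_length_eq tree _ codomE).
  by rewrite /volume (hull_length_between (codom_f P (i, false)) cz).
have sp : hull_length p (c :: S) + hull_length c T <= volume b' P.
  rewrite volP; apply: hull_length_split => // [y1|x1 y1] /mapP[b1].
    by rewrite mem_filter => /andP[/eqP nb _] ->; have := far_side b1; rewrite nb.
  rewrite mem_filter => /andP[/eqP nb1 _] -> /mapP[b2].
  rewrite mem_filter => /andP[/eqP nb2 _] ->.
  apply: le_anti; rewrite gromov_ge0 andbT.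
  have := far_side b2; rewrite nb2 => /eqP; rewrite eq_le => /andP[/= + _].
  move=> /(four_point_le_or (P b1) tree) [|//].
  by have := near_side b1; rewrite nb1; have := r00; lra.
(* The far piece is rerooted from [c] to [z false], which [h i] inverse carries to [z true]. *)
have glued : hull_length c T = hull_length p (map (act (h i)^-1%g) (c :: T)).
  rewrite -(hull_length_eq tree c (_ : q :: T =i T)); last first.
    by move=> u; rewrite inE; case: eqP => [->|].
  rewrite (hull_length_rerooted tree) -(hull_length_isom _ _ (act_dist isom (h i)^-1%g)).
  by congr hull_length; exact: (tau_z false).
have := @hull_length_merge _ _ tree p (c :: S) (map (act (h i)^-1%g) (c :: T)) x
  (act (h i)^-1%g y) xS (map_f _ yS).
set U := _ ++ _ => merge.
suff : volume b recut <= hull_length p U by rewrite glued in sp; lra.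
apply: (@le_trans _ _ (hull_length p (codom recut))).
  by apply: hull_length_root_le; rewrite // codom_f.
apply: hull_length_sub => // _ /codomP[b1 ->]; rewrite /U mem_cat /recut.
have := piece_mem b1.
by case: (side b1) => QT; rewrite ?(act1 isom) ?QT// map_f ?orbT.
Qed.

Lemma recut_volume_le b b' : volume b recut <= volume b' P.
Proof.
apply: le_trans (recut_volume b b' (mem_head _ _) (mem_head _ _)) _.
by rewrite gerBl gromov_ge0.
Qed.

Lemma recut_near_minimal : near_minimal e recut.
Proof.
move=> h' P' b b' gh' hP'; apply: le_trans (recut_volume_le b b') _.
exact: min gh' hP'.
Qed.

(** By [recut_volume] an overlap is length saved, and near minimality of [P] leaves at most [e] to
    save. *)
Lemma recut_overlap b b' : side b != side b' -> gp (z true) (recut b) (recut b') <= e.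
Proof.
wlog sb : b b' / side b => [wl bb'|].
  have [/wl|nb] := boolP (side b); first exact.
  rewrite gromovC wl // 1?eq_sym //.
  by move: bb' nb; case: (side b) => //; case: (side b').
rewrite sb => nb'; have := piece_mem b; have := piece_mem b'.
rewrite /recut sb; case: (side b') nb' => // _ b'T bS; rewrite (act1 isom).
have := recut_volume b b bS b'T.
have := min b b recut_nielsen recut_paired.
by rewrite /tau; lra.
Qed.

(* [z (side b)] is the point of the piece of [b] along which [recut] glues. *)
Lemma long_anchor b : b.1 \in i :: s -> r <= d (z (side b)) (Q b) /\
  forall b', b' != b -> side b' = side b -> r <= gp (Q b) (z (side b)) (Q b').
Proof.
have near_dist b' : b'.1 != i -> r <= gp c (z (side b')) (P b').
  by move=> bi; rewrite /side (negbTE bi); apply: le_trans rr0 (near_side _).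
rewrite inE; have [bi _|bi /= bs] := eqVneq b.1 i.
  rewrite /Q bi eqxx; split.
    rewrite metric_sym -gromovxx; apply: le_trans rr0 _.
    by have := near_side (i, side b); rewrite near_z.
  move=> b' bb' sbb'; have b'i : b'.1 != i.
    apply: contraNneq bb' => b'i; move: sbb'; rewrite /side bi b'i eqxx => /negb_inj.
    by case: (b) (b') bi b'i => [? ?] [? ?] /= -> -> ->.
  by rewrite (negbTE b'i) -sbb'; apply: near_dist.
have lb : long r P b by case: (b) bs => j t; apply: longs.
have zb t : (i, t) != b by apply: contraNneq bi => <-.
rewrite /Q (negbTE bi); split.
  by rewrite metric_sym -gromovxx; apply: lb.
move=> b' bb' sbb'; case: eqP => [_|_]; last exact: lb.
(* Here [Q b'] is [c], which lies between [P b] and the end on the other side; that end is covered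
   by the long leg at [P b]. *)
apply: (four_point_le (y := z (~~ side b)) tree); first exact: lb.
rewrite gromovC gromov_swap (gromovC c); have := far_side b.
rewrite /side (negbTE bi) => ->; rewrite subr0 metric_sym.
apply: le_trans (near_dist _ bi) _; rewrite gromovC; exact: gromov_le.
Qed.

(** All products are compared with the gluing point [z true]. Within one piece [long_anchor]
    applies; across the pieces the overlap costs at most [e]. *)
Lemma recut_long b : b.1 \in i :: s -> long (r - e) recut b.
Proof.
move=> /long_anchor[zb sb].
suff anchor b' : b' != b -> r - e <= gp (recut b) (z true) (recut b').
  move=> b1 b2 /anchor h1 /anchor h2.
  by apply: (four_point_le (y := z true)) => //; rewrite gromovC.
move=> bb'; have [sbb'|sbb'] := eqVneq (side b') (side b).
  rewrite -(tau_z (side b)) /recut sbb' (act_gromov isom).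
  by have := sb b' bb' sbb'; have := e0; lra.
have dz : d (recut b) (z true) = d (z (side b)) (Q b).
  by rewrite -(tau_z (side b)) (act_dist isom) metric_sym.
rewrite eq_sym in sbb'.
by rewrite gromov_swap dz; have := recut_overlap sbb'; lra.
Qed.

End Recut.

(** One exchange per index makes the legs of that index long and costs the earlier ones [e]. The
    bound on translation lengths holds for every equivalent tuple, so a cut point of clearance [r]
    is always available. *)
Lemma exists_long h P (r e : R) (s : seq 'I_n) :
  nielsen_equivalent g h -> paired act h P -> near_minimal e P -> 0 <= e -> 0 < r ->
  (forall h' i, nielsen_equivalent g h' ->
     2 * #|{: letter n}|.+1%:R * r <= translation_length act (h' i)) ->
  exists h' P', [/\ nielsen_equivalent g h', paired act h' P', near_minimal e P' &
    forall b, b.1 \in s -> long (r - (size s)%:R * e) P' b].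
Proof.
move=> gh hP minP e0 r0 tl; elim: s => [|i s [h' [P' [gh' hP' minP' lP']]]].
  by exists h, P; split.
have iP : 2 * #|{: letter n}|.+1%:R * r <= d (P' (i, true)) (P' (i, false)).
  apply: le_trans (tl h' i gh') _; rewrite (hP' (i, false)).
  apply: ge_inf; last by exists (P' (i, true)).
  by exists 0 => _ [x _ <-]; exact: mdist_ge0.
have [_ geo _] := tree.
have [c cz clear] := exists_clear_point P' geo r0 iP.
have se : r - (size s)%:R * e <= r by rewrite gerBl mulr_ge0.
have longs j t : j \in s -> long (r - (size s)%:R * e) P' (j, t).
  by move=> js; apply: lP'.
exists (recut_tuple h' P' i c r), (recut h' P' i c r); split.
- exact: recut_nielsen.
- exact: recut_paired.
- exact: recut_near_minimal.
- move=> b bs; rewrite /= -natr1 mulrDl mul1r opprD addrA.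
  exact: (recut_long gh' hP' e0 minP' r0 se longs cz clear).
Qed.

(* Folding [P a] and its partner by [e] into the hull shortens the hull by [2 e]. *)
Lemma near_minimal_unfolded h P (e : R) a b c :
  nielsen_equivalent g h -> paired act h P -> near_minimal e P -> 0 < e ->
  (forall a, long (4 * e) P a) -> b != a -> c != inv_letter a ->
  gp (P a) (P b) (act (eval_letter h a) (P c)) <= e.
Proof.
move=> gh hP minP e0 lP ba ca; rewrite leNgt; apply/negP => fold.
have [_ geo _] := tree; set a' := inv_letter a in ca.
have aa' : a' != a by exact: inv_letter_neq.
have lab : 4 * e <= d (P a) (P b) by rewrite -gromovxx; apply: lP.
(* [x] is the point at distance [e] from [P a] towards [P b]; it will replace [P a], and its
   translate [y] will replace [P a']. *)
have [|x ax xb] := @interpolate _ _ (P a) (P b) e geo; first by lra.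
have xt t : e <= gp (P a) (P b) t -> d x t <= d (P a) t - e.
  move=> bt; have xab : e <= gp (P a) x (P b) by rewrite /gromov ax xb; lra.
  by have := four_point_le tree xab bt; rewrite /gromov ax; lra.
pose y := act (eval_letter h a)^-1%g x.
have ay : d (P a') y = e.
  by rewrite -ax [P a]hP -(act_dist isom (eval_letter h a)) (actVK isom).
have yt t : d y t = d x (act (eval_letter h a) t).
  by rewrite -(act_dist isom (eval_letter h a)) (actVK isom).
(* The leg at [P a'] is long, so the translates of all other [P b1] leave [P a] in the direction of
   that of [P c], which by [fold] is the direction of [P b]. *)
have yc b1 : b1 != a' -> d y (P b1) <= d (P a') (P b1) - e.
  move=> b1a'; rewrite yt -[d (P a') _](act_dist isom (eval_letter h a)) -hP.
  apply/xt/(four_point_le tree (ltW fold)).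
  rewrite [P a]hP (act_gromov isom); have := lP a' c b1 ca b1a'; lra.
have xb1 b1 : b1 != a -> d x (P b1) <= d (P a) (P b1) - e.
  by move=> b1a; apply: xt; have := lP a b b1 ba b1a; lra.
pose P' b1 := if b1 == a then x else if b1 == a' then y else P b1.
have hP' : paired act h P'.
  move=> b1; rewrite /P'; have [->|b1a] := eqVneq b1 a.
    by rewrite -/a' (negbTE aa') eqxx (actVK isom).
  have [->|b1a'] := eqVneq b1 a'; first by rewrite inv_letterK eqxx eval_letter_inv.
  rewrite (can2_eq (@inv_letterK n) (@inv_letterK n)) -/a' (negbTE b1a').
  by rewrite (inj_eq (can_inj (@inv_letterK n))) (negbTE b1a).
pose rest := [seq P b1 | b1 <- enum {: letter n} & (b1 != a) && (b1 != a')].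
have restP b1 : b1 != a -> b1 != a' -> P b1 \in rest.
  by move=> b1a b1a'; rewrite map_f // mem_filter b1a b1a' mem_enum.
have vP : hull_length (P a') (P a :: rest) <= volume a' P.
  apply: hull_length_sub => // u; rewrite inE => /predU1P[->|/mapP[b1 _ ->]];
  exact: codom_f.
have vP' : volume a P' <= hull_length x (y :: rest).
  rewrite /volume {1}/P' eqxx -(hull_length_root_cons x (y :: rest)).
  apply: hull_length_sub => // _ /codomP[b1 ->]; rewrite /P' !inE.
  have [_|b1a] := eqVneq b1 a; first by rewrite eqxx.
  have [_|b1a'] := eqVneq b1 a'; first by rewrite eqxx orbT.
  by rewrite restP ?orbT.
have xa' : d x (P a') <= d (P a) (P a') - e by apply: xb1.
(* The two ends are slid one after the other, with a change of root in between; the total gain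
   [2 * e] exceeds the [e] allowed. *)
have s1 : hull_length (P a') (x :: rest) + e <= hull_length (P a') (P a :: rest).
  apply: hull_length_slide; first by rewrite metric_sym (metric_sym (P a')).
  by move=> _ /mapP[b1 + ->]; rewrite mem_filter => /andP[/andP[/xb1]].
have s2 : hull_length x (y :: rest) + e <= hull_length x (P a' :: rest).
  apply: hull_length_slide.
    (* [yc] concerns only the old points, but [P a] has already moved to [x]. Seen from [P a'], the
       points [x] and [P a] still share a segment of length [e]. *)
    have ya : d y (P a) <= d (P a') (P a) - e by apply: yc; rewrite eq_sym.
    have Dxa := metric_triangle (P a') x (P a).
    have : 4 * e <= d (P a) (P a') by rewrite -gromovxx; apply: lP.
    rewrite (metric_sym (P a)) => D4.
    have e1 : e <= gp (P a') y (P a) by rewrite /gromov; lra.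
    have e2 : e <= gp (P a') (P a) x.
      by rewrite /gromov ax; rewrite (metric_sym x (P a)) ax in Dxa; lra.
    have := four_point_le tree e1 e2; rewrite /gromov ay (metric_sym x y).
    by rewrite (metric_sym x (P a')); lra.
  by move=> _ /mapP[b1 + ->]; rewrite mem_filter => /andP[/andP[_ /yc]].
have := minP h P' a' a gh hP'; have := hull_length_rerooted tree x (P a') rest; lra.
Qed.

End Exchange.

(** * Assembling the dichotomy *)

Lemma exists_near_minimal (R : realType) (G : groupType) (n : nat) (X : metricType R)
    (act : G -> X -> X) (g : {ffun 'I_n -> G}) (e : R) :
  R_tree X -> isometric_action act -> 0 < e ->
  exists h P, [/\ nielsen_equivalent g h, paired act h P & near_minimal act g e P].
Proof.
move=> tree isom e0; have [[x _] _ _] := tree.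
pose P0 (a : letter n) := if a.2 then x else act (g a.1) x.
have gP0 : paired act g P0 by apply: paired_half.
have gg : nielsen_equivalent g g by exact: rt_refl.
(* Without letters near minimality is vacuous, being quantified over roots. *)
have [b0|nob] := pickP [pred b : letter n | true]; last first.
  by exists g, P0; split=> // ? ? b; have := nob b.
pose E := [set v : R | exists h P, [/\ nielsen_equivalent g h, paired act h P &
  v = volume b0 P]].
have Einf : has_inf E.
  split; first by exists (volume b0 P0), g, P0.
  by exists 0 => _ [h [P [_ _ ->]]]; exact: hull_length_ge0.
have [_ [h [P [gh hP ->]]] lt_inf] := inf_adherent e0 Einf.
exists h, P; split=> // h' P' b b' gh' hP'.
rewrite (volume_root tree P b b0) (volume_root tree P' b' b0).
apply: le_trans (ltW lt_inf) _; rewrite lerD2r; apply: ge_inf; first exact: Einf.2.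
by exists h', P'.
Qed.

(** The theorem speaks of the first entry only; a swap extends the lower bound to every entry. *)
Lemma nielsen_to_front (G : groupType) (n : nat) (h : {ffun 'I_n -> G}) (i0 i : 'I_n) :
  exists2 h', nielsen_equivalent h h' & h' i0 = h i.
Proof.
have [->|i0i] := eqVneq i i0; first by exists h => //; exact: rt_refl.
exists [ffun k => h (tperm i0 i k)]; last by rewrite ffunE tpermL.
by apply/rt_step/NielsenSwap; rewrite eq_sym.
Qed.

Theorem corollary2 (R : realType) (G : groupType) (n : nat)
    (g : {ffun 'I_n -> G}) (X : metricType R) (act : G -> X -> X)
    (g_gen : generates g) (X_tree : R_tree X)
    (act_isom : isometric_action act) :
  [/\ free_basis g,
      acts_freely act &
      forall x : X, quasi_isometric_embedding
        (word_dist R g) (@mdist R X) (fun h : G => act h x)]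
  \/
  (forall eps : R, 0 < eps ->
    exists h : {ffun 'I_n -> G}, nielsen_equivalent g h /\
      exists i : 'I_n, i = 0%N :> nat /\ translation_length act (h i) <= eps).
Proof.
rewrite orC -implyNp => /existsPNP[eps eps0 short].
pose N : R := #|{: letter n}|.+1%:R; have N0 : 0 < 2 * N by rewrite mulr_gt0.
have tl h i : nielsen_equivalent g h ->
    2 * N * (eps / (2 * N)) <= translation_length act (h i).
  move=> gh; rewrite mulrC divfK ?gt_eqF// leNgt; apply/negP => hi.
  pose i0 := Ordinal (leq_ltn_trans (leq0n i) (ltn_ord i)).
  have [h' hh' e] := nielsen_to_front h i0 i.
  apply: short; exists h'; split; first exact: rt_trans gh hh'.
  by exists i0; split=> //; rewrite e ltW.
set r := eps / (2 * N) in tl; have r0 : 0 < r by rewrite divr_gt0.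
(* The [n] exchanges consume [n * e] of the leg length [r], which leaves [4 * e]. *)
pose e := r / (n%:R + 4); have n4 : 0 < n%:R + 4 :> R by rewrite ltr_wpDl.
have e0 : 0 < e by rewrite divr_gt0.
have [h0 [P0 [gh0 hP0 min0]]] := exists_near_minimal g X_tree act_isom e0.
have [h [P [gh hP minP longP]]] :=
  exists_long X_tree act_isom (enum 'I_n) gh0 hP0 min0 (ltW e0) r0 tl.
have {}longP a : long (4 * e) P a.
  have re : r = (n%:R + 4) * e by rewrite mulrC divfK ?gt_eqF.
  have := longP a; rewrite mem_enum size_enum_ord => /(_ isT) la b c ba ca.
  by apply: le_trans (la b c ba ca); rewrite re mulrDl; lra.
have sep a b : a != b -> 4 * e <= mdist (P a) (P b).
  by move=> ab; rewrite -gromovxx; apply: longP; rewrite eq_sym.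
have unfolded a b c : b != a -> c != inv_letter a ->
    gromov (P a) (P b) (act (eval_letter h a) (P c)) <= e.
  exact: (near_minimal_unfolded X_tree act_isom gh hP minP e0 longP).
have gen := generates_nielsen gh g_gen.
split.
- apply: free_basis_nielsen gh _ => //.
  exact: (ping_pong_free_basis X_tree act_isom e0 hP sep unfolded).
- exact: (ping_pong_acts_freely X_tree act_isom e0 hP sep unfolded).
- move=> x.
  exact: (ping_pong_quasi_isometric X_tree act_isom e0 hP sep unfolded).
Qed.
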